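(* Let $p$ be a prime such that $p^* < p$. Then $p \mid \binom{0}{0}_F\binom{p^*}{1}_F$ but $p \nmid \binom{(p^* )^2}{p^*}_F$.
   Context: The Fibonacci sequence is $F_1=F_2=1$, $F_n=F_{n-1}+F_{n-2}$ for $n\ge 3$. For a prime $p$, $p^*$ denotes the least positive integer $n$ such that $p\mid F_n$ (it exists for every prime). The fibotorial is $n!_F = F_nF_{n-1}\cdots F_1$ for $n>0$, and $0!_F=1$. The fibonomial coefficient is $\binom{n}{k}_F=\frac{n!_F}{k!_F\,(n-k)!_F}$ for $0\le k\le n$, and $\binom{n}{k}_F=0$ otherwise; it is always an integer. *)

(* Defs.v *)
From mathcomp Require Import all_boot.
Set Implicit Arguments.
Unset Strict Implicit.
Unset Printing Implicit Defensive.

(* The value at 0 extends the recurrence backwards; F_1 = F_2 = 1. *)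
Fixpoint fib (n : nat) : nat :=
  match n with
  | 0 => 0
  | n1.+1 => match n1 with
             | 0 => 1
             | n2.+1 => fib n1 + fib n2
             end
  end.

Definition fibotorial (n : nat) : nat := \prod_(1 <= i < n.+1) fib i.

(* The division is exact: see fibonomial_mul below. *)
Definition fibonomial (n k : nat) : nat :=
  if k <= n then fibotorial n %/ (fibotorial k * fibotorial (n - k)) else 0.

Lemma fibSS n : fib n.+2 = fib n.+1 + fib n.
Proof. by []. Qed.

Lemma fib_gt0 n : 0 < n -> 0 < fib n.
Proof.
case: n => // n _; elim: n => // n IHn.
by rewrite fibSS addn_gt0 IHn.
Qed.

Lemma fib_add m n : fib (m + n).+1 = fib m.+1 * fib n.+1 + fib m * fib n.
Proof.
elim: m n => [|m IHm] n; first by rewrite mul1n mul0n addn0.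
rewrite addSnnS IHm !fibSS !mulnDl !mulnDr -!addnA; congr (_ + _).
by rewrite addnC.
Qed.

Lemma fibotorialS n : fibotorial n.+1 = fib n.+1 * fibotorial n.
Proof. by rewrite /fibotorial big_nat_recr //= mulnC. Qed.

Lemma fibotorial0 : fibotorial 0 = 1.
Proof. by rewrite /fibotorial big_geq. Qed.

Lemma fibotorial_gt0 n : 0 < fibotorial n.
Proof.
elim: n => [|n IHn]; first by rewrite fibotorial0.
by rewrite fibotorialS muln_gt0 fib_gt0.
Qed.

Lemma dvdn_fibotorial m n : fibotorial m * fibotorial n %| fibotorial (m + n).
Proof.
elim: m n => [|m IHm]; first by move=> n; rewrite fibotorial0 mul1n.
elim=> [|n IHn]; first by rewrite fibotorial0 muln1 addn0.
rewrite addnS [fibotorial (_ + _).+1]fibotorialS (fib_add m.+1 n) mulnDl.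
apply: dvdn_add.
- rewrite [fibotorial n.+1]fibotorialS mulnCA [fib m.+2 * _]mulnC -mulnA.
  by rewrite dvdn_pmul2l ?fib_gt0 // dvdn_mull.
- rewrite [fibotorial m.+1]fibotorialS -!mulnA dvdn_pmul2l ?fib_gt0 //.
  by rewrite dvdn_mull // addSnnS.
Qed.

Lemma fibonomial_mul n k :
  k <= n -> fibonomial n k * (fibotorial k * fibotorial (n - k)) = fibotorial n.
Proof.
by move=> le_kn; rewrite /fibonomial le_kn divnK // -{2}(subnKC le_kn)
  dvdn_fibotorial.
Qed.

Lemma fib_mod_descent p i d :
  fib i = fib (i + d) %[mod p] -> fib i.+1 = fib (i + d).+1 %[mod p] ->
  p %| fib d.
Proof.
elim: i => [|i IHi] eq0 eq1; first by rewrite /dvdn -[fib d]/(fib (0 + d)) -eq0 mod0n.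
apply: IHi => //; apply/eqP; rewrite -(eqn_modDl (fib i.+1)) -fibSS.
by rewrite eq1 addSn fibSS -modnDml -eq0 modnDml.
Qed.

Lemma fib_rank_ex p : prime p -> exists n, (0 < n) && (p %| fib n).
Proof.
move=> p_pr; have p_gt0 := prime_gt0 p_pr.
pose r n : 'I_p := Ordinal (ltn_pmod n p_gt0).
pose f (i : 'I_(p * p).+1) := (r (fib i), r (fib i.+1)).
have: ~~ injectiveb f.
  apply/injectiveP => /leq_card.
  by rewrite card_prod !card_ord ltnn.
case/injectivePn=> i [j ne_ij eq_f].
wlog lt_ij : i j ne_ij eq_f / i < j.
  move=> W; have [lt|lt|/val_inj e] := ltngtP i j; first exact: (W i j).
    by apply: (W j i); rewrite // eq_sym.
  by rewrite e eqxx in ne_ij.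
case: eq_f => e0 e1; exists (j - i); rewrite subn_gt0 lt_ij /=.
by apply: (@fib_mod_descent p i); rewrite subnKC // ltnW.
Qed.

(* p^*: the least n > 0 with p %| fib n. *)
Definition fib_rank (p : nat) (p_pr : prime p) : nat :=
  ex_minn (fib_rank_ex p_pr).

(* Main.v *)
Require Import Defs.
From mathcomp Require Import all_boot.

(** Write r = p^*.  In [r^2 choose r]_F the numerators F_{r^2-r+i}, 0 < i < r,
are prime to p, so only the quotient F_{r^2} / F_r matters; it is congruent to
r * F_{r+1}^(r-1) modulo F_r, hence to a unit modulo p because 0 < r < p. *)

Lemma coprime_fibS n : coprime (fib n) (fib n.+1).
Proof.
elim: n => [|n IHn]; first by rewrite /coprime.
by rewrite fibSS /coprime gcdnDl -/(coprime _ _) coprime_sym.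
Qed.

(** Each addition of r to the index multiplies by [fib r.+1], since the other term of [fib_add] has
    the factor [fib r]. *)
Lemma fib_mulS_mod r m : fib (m * r).+1 = fib r.+1 ^ m %[mod fib r].
Proof.
elim: m => [|m IHm]; first by rewrite mul0n expn0.
by rewrite mulSnr fib_add expnSr -modnDmr modnMl addn0 -modnMml IHm modnMml.
Qed.

(** The quotient is an explicit witness because it cannot be recovered from residues modulo [fib r],
    where [fib r] is zero. *)
Lemma fib_mul_quotient r m : 0 < r ->
  exists2 c, fib (m.+1 * r) = fib r * c &
    c = m.+1 * fib r.+1 ^ m %[mod fib r].
Proof.
case: r => // s _; elim: m => [|m [c def_c mod_c]].
  by exists 1; rewrite ?mul1n ?muln1.
exists (fib (m.+1 * s.+1).+1 + c * fib s).
  by rewrite mulSnr addnS fib_add def_c mulnDr -mulnA mulnC.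
(* With r = s + 1, F_{r-1} and F_{r+1} agree modulo F_r, so the new quotient becomes F_{r+1}^(m+1) +
   (m+1) F_{r+1}^m F_{r+1}. *)
have mod_s : fib s = fib s.+2 %[mod fib s.+1] by rewrite fibSS modnDl.
rewrite -modnDm fib_mulS_mod -(modnMm c) mod_c mod_s modnMm modnDm.
by rewrite -mulnA -expnSr -mulSn.
Qed.

Lemma dvdn_fib_mul r m : 0 < r -> fib r %| fib (m * r).
Proof.
case: m => [|m] r_gt0; first by rewrite mul0n dvdn0.
by have [c -> _] := fib_mul_quotient r m r_gt0; apply: dvdn_mulr.
Qed.

Lemma fibotorial_add n k :
  fibotorial (n + k) = fibotorial n * \prod_(i < k) fib (n + i).+1.
Proof.
elim: k => [|k IHk]; first by rewrite addn0 big_ord0 muln1.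
by rewrite addnS fibotorialS IHk big_ord_recr mulnC -mulnA.
Qed.

Lemma fibonomial_n1 n : 0 < n -> fibonomial n 1 = fib n.
Proof.
case: n => // n _; apply/eqP.
rewrite -(eqn_pmul2r (fibotorial_gt0 n)) -fibotorialS.
by rewrite -(@fibonomial_mul n.+1 1) // subn1 fibotorialS fibotorial0 !mul1n.
Qed.

Section FibRank.

Variables (p : nat) (p_pr : prime p).
Let r := fib_rank p_pr.

Lemma fib_rank_gt0 : 0 < r.
Proof. by rewrite /r /fib_rank; case: ex_minnP => n /andP[]. Qed.

Lemma dvdn_fib_rank : p %| fib r.
Proof. by rewrite /r /fib_rank; case: ex_minnP => n /andP[]. Qed.

Lemma fib_rank_min i : 0 < i < r -> ~~ (p %| fib i).
Proof.
rewrite /r /fib_rank; case: ex_minnP => n _ min_n /andP[i_gt0].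
by apply: contraL => p_i; rewrite -leqNgt min_n // i_gt0.
Qed.

Lemma dvdn_fib_ndvdS n : p %| fib n -> ~~ (p %| fib n.+1).
Proof.
move=> p_n; rewrite -prime_coprime //.
exact: coprime_dvdl p_n (coprime_fibS n).
Qed.

(** Modulo p only F_{mr+1} F_{i+1} survives in [fib_add]. The first factor is a unit because it
    follows a multiple of p, the second by minimality of r. *)
Lemma fib_rank_mulD_ndvd m i : i.+1 < r -> ~~ (p %| fib (m * r + i).+1).
Proof.
move=> lt_ir; have p_mr : p %| fib (m * r).
  exact: dvdn_trans dvdn_fib_rank (dvdn_fib_mul _ _ fib_rank_gt0).
rewrite fib_add (dvdn_addl _ (dvdn_mulr _ p_mr)) Euclid_dvdM // negb_or.
by rewrite dvdn_fib_ndvdS ?fib_rank_min.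
Qed.

Lemma fib_rank_fibonomial_ndvd m :
  ~~ (p %| m.+1) -> ~~ (p %| fibonomial (m.+1 * r) r).
Proof.
move=> p'm; have r_gt0 := fib_rank_gt0.
have [c def_c mod_c] := fib_mul_quotient r m r_gt0.
have p'c : ~~ (p %| c).
  (* The congruence modulo F_r descends to p because p divides F_r. *)
  have -> : (p %| c) = (p %| m.+1 * fib r.+1 ^ m).
    rewrite /dvdn -(modn_dvdm c dvdn_fib_rank) mod_c.
    by rewrite modn_dvdm ?dvdn_fib_rank.
  rewrite Euclid_dvdM // negb_or p'm Euclid_dvdX // negb_and.
  by rewrite dvdn_fib_ndvdS ?dvdn_fib_rank.
have le_r : r <= m.+1 * r by rewrite leq_pmull.
have := fibonomial_mul le_r.
have -> : m.+1 * r - r = m * r by rewrite mulSnr addnK.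
rewrite [in fibotorial (m.+1 * r)]mulSnr fibotorial_add.
move: fib_rank_mulD_ndvd def_c r_gt0.
case: r => // s p'F def_c _.
rewrite big_ord_recr -addnS -mulSnr def_c fibotorialS.
set P := \prod_(i < s) _; set b := fibonomial _ _ => Eb.
(* Cancel (mr)!_F and the factor F_r, which occurs both in r!_F and in the top numerator F_{(m+1)r}
   = F_r c. *)
have {}Eb : b * fibotorial s = P * c.
  apply/eqP; rewrite -(eqn_pmul2l (fib_gt0 (ltn0Sn s))).
  rewrite -(eqn_pmul2r (fibotorial_gt0 (m * s.+1))); apply/eqP.
  by rewrite mulnCA -mulnA Eb [RHS]mulnC [fib _ * (P * c)]mulnCA.
have p'P : ~~ (p %| P).
  apply: (big_ind (fun n => ~~ (p %| n))) => [|x y p'x p'y|i _].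
  - by rewrite Euclid_dvd1.
  - by rewrite Euclid_dvdM // negb_or p'x.
  - exact/p'F/(ltn_ord i).
apply/negP => p_b; have: p %| P * c by rewrite -Eb dvdn_mulr.
by rewrite Euclid_dvdM // (negPf p'c) (negPf p'P).
Qed.

End FibRank.

Theorem theorem4p3 (p : nat) (p_pr : prime p) :
  fib_rank p_pr < p ->
  (p %| fibonomial 0 0 * fibonomial (fib_rank p_pr) 1) /\
  ~ (p %| fibonomial (fib_rank p_pr ^ 2) (fib_rank p_pr)).
Proof.
move=> lt_rp; have r_gt0 := fib_rank_gt0 _ p_pr; split.
  by rewrite dvdn_mull // fibonomial_n1 // dvdn_fib_rank.
(* Take m = r - 1, so that m + 1 = r is prime to p by 0 < r < p. *)
apply/negP; rewrite -mulnn -{1}(prednK r_gt0).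
by apply: fib_rank_fibonomial_ndvd; rewrite prednK // gtnNdvd.
Qed.
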